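(* Let $0<\epsilon<1/2$ be a fixed constant. Let $A$ be a quantum algorithm that solves the reconstruction problem, meaning that for every $f:[n]\to[m]$, with probability at least $2/3$, it outputs a probability distribution $\mathcal{P}\in[0,1]^m$ such that $\|\mathcal{P}-\mathcal{P}_f\|_1\le\epsilon$. Then $A$ makes $\Omega(m/\log m)$ queries to $f$.
   Context: Notation: $[n]=\{1,\dots,n\}$. For $f:[n]\to[m]$, $\mathcal{P}_f$ is the probability distribution on $[m]$ given by $\mathcal{P}_f(j)=|f^{-1}(j)|/n$, and $\|\mathcal{P}-\mathcal{P}_f\|_1=\sum_{j\in[m]}|\mathcal{P}(j)-\mathcal{P}_f(j)|$. The algorithm accesses $f$ only via quantum queries, i.e. applications of the unitary $|x\rangle|b\rangle\mapsto|x\rangle|b\oplus f(x)\rangle$, where $x$ is a $\log n$-bit string, $b,f(x)$ are $\log m$-bit strings and $\oplus$ is bitwise addition modulo two. The algorithm is given $n$ and $m$ and must be correct for all $n$, $m$ and all $f:[n]\to[m]$; the bound concerns the worst-case number of queries, over $n$ and $f$, as a function of $m$ (for $m\to\infty$). *)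

(* Defs.v *)
(* Amplitudes live in R[i], for R : realType. *)
From HB Require Import structures.
From mathcomp Require Import all_boot all_order all_algebra.
From mathcomp Require Import complex.
From mathcomp Require Import all_classical all_reals all_analysis.

Set Implicit Arguments.
Unset Strict Implicit.
Unset Printing Implicit Defensive.
Import Order.TTheory GRing.Theory Num.Theory.

Local Open Scope ring_scope.
Local Open Scope complex_scope.

(* The number of bits of an element of an n-element set: the least k with
   n <= 2 ^ k, i.e. log n when n is a power of two. *)
Definition nbits (n : nat) : nat := up_log 2 n.

(* [n] is represented by 'I_n = {0, ..., n-1}, and i : 'I_n by its binary
   expansion, least significant bit first. *)
Definition bits (n : nat) (i : 'I_n) : (nbits n).-tuple bool :=
  [tuple odd (i %/ 2 ^ k) | k < nbits n].

Definition xor_bits (k : nat) (b c : k.-tuple bool) : k.-tuple bool :=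
  [tuple tnth b i (+) tnth c i | i < k].

(* When n is not a power of two, a string that encodes no element of [n] is
   sent to the zero string, so that the oracle acts trivially on it. *)
Definition query_answer (n m : nat) (f : {ffun 'I_n -> 'I_m})
    (x : (nbits n).-tuple bool) : (nbits m).-tuple bool :=
  if [pick i | bits i == x] is Some i then bits (f i)
  else [tuple false | _ < nbits m].

(* The computational basis |x>|b>|z>, with a workspace of dimension w.+1. *)
Definition basis (n m w : nat) : finType :=
  ((nbits n).-tuple bool * (nbits m).-tuple bool * 'I_w.+1)%type.

Definition oracle_fun (n m w : nat) (f : {ffun 'I_n -> 'I_m})
    (s : basis n m w) : basis n m w :=
  let: (x, b, z) := s in (x, xor_bits b (query_answer f x), z).

Definition basis0 (n m w : nat) : basis n m w :=
  ([tuple false | _ < nbits n], [tuple false | _ < nbits m], ord0).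

Section QueryAlgorithms.
Variable R : realType.

Definition ket (B : finType) (s : B) : 'cV[R[i]]_#|B| :=
  \col_i (i == enum_rank s)%:R.

Definition oracle (n m w : nat) (f : {ffun 'I_n -> 'I_m}) :
    'M[R[i]]_#|basis n m w| :=
  \matrix_(i, j) (enum_val i == oracle_fun f (enum_val j))%:R.

(* A quantum query algorithm for inputs f : [n] -> [m]: it computes the state
     gate T * O_f * gate (T-1) * ... * O_f * gate 0 * |0,0,0>,
   where T = queries, measures it in the computational basis, and returns the
   vector that output assigns to the outcome. Intermediate measurements,
   randomness and general final measurements are absorbed in the workspace. *)
Record algorithm (n m : nat) := Algorithm {
  queries : nat;
  work : nat;
  gate : nat -> 'M[R[i]]_#|basis n m work|;
  gate_unitary : forall t, gate t \is unitarymx;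
  output : basis n m work -> {ffun 'I_m -> R}
}.

Fixpoint state (n m : nat) (A : algorithm n m) (f : {ffun 'I_n -> 'I_m})
    (t : nat) : 'cV[R[i]]_#|basis n m (work A)| :=
  match t with
  | 0%N => gate A 0 *m ket (basis0 n m (work A))
  | t'.+1 => gate A t *m (oracle (work A) f *m state A f t')
  end.

Definition outcome_prob (n m : nat) (A : algorithm n m)
    (f : {ffun 'I_n -> 'I_m}) (s : basis n m (work A)) : R :=
  Normc.normc (state A f (queries A) (enum_rank s) 0) ^+ 2.
Arguments outcome_prob {n m} A f s.

Definition output_prob (n m : nat) (A : algorithm n m)
    (f : {ffun 'I_n -> 'I_m}) (E : pred {ffun 'I_m -> R}) : R :=
  \sum_(s | E (output s)) outcome_prob A f s.

Definition is_distr (m : nat) (P : {ffun 'I_m -> R}) : bool :=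
  [forall j, 0 <= P j <= 1] && (\sum_j P j == 1).

Definition L1dist (m : nat) (P Q : {ffun 'I_m -> R}) : R :=
  \sum_j `|P j - Q j|.

Definition distr_of (n m : nat) (f : {ffun 'I_n -> 'I_m}) : {ffun 'I_m -> R} :=
  [ffun j => #|[pred i | f i == j]|%:R / n%:R].

Definition solves_reconstruction (eps : R)
    (A : forall n m : nat, algorithm n m) : Prop :=
  forall n m : nat, (0 < n)%N -> forall f : {ffun 'I_n -> 'I_m},
    2 / 3 <= output_prob (A n m) f
               (fun P => is_distr P && (L1dist P (distr_of f) <= eps)).

(* The worst-case number of queries as a function of m; a supremum over all n
   may be infinite. *)
Definition worst_queries (A : forall n m : nat, algorithm n m) (m : nat) :
    \bar R :=
  ereal_sup [set ((queries (A n m))%:R)%:E | n in [set n : nat | (0 < n)%N]].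

End QueryAlgorithms.

(* Main.v *)
(* Fix an injection h of [k] x [16] into [m], with k about m/16, and consider
   the 16 ^ k inputs f_c i = h (i, c i), for words c in [16]^k.  The L1 distance
   between the distributions of f_c and f_d is 2/k times the Hamming distance
   of c and d, so (as 2 eps < 1) a single output is correct only for words at
   mutual distance at most k/2, of which there are at most 8 ^ k.
   One query is a combination of km+1 operators that do not depend on the
   input, so the states after T queries, for all inputs together, lie in a
   space of dimension at most (km+1)^T.  With an orthonormal basis of this
   space, the success probabilities sum over c to at most 8 ^ k (km+1)^T, hence
   (2/3) 2 ^ k <= (km+1)^T, i.e. T = Omega (m / log m). *)
Require Import Defs.
From HB Require Import structures.
From mathcomp Require Import all_boot all_order all_algebra.
From mathcomp Require Import complex.
From mathcomp Require Import all_classical all_reals all_analysis.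
From mathcomp Require Import zify lra.
Import Order.TTheory GRing.Theory Num.Theory.
Local Open Scope ring_scope.
Local Open Scope sesquilinear_scope.
Local Open Scope complex_scope.

(** * Measuring unit vectors of a low-dimensional subspace *)

(** Let the rows of [Q] be an orthonormal basis of [V]. By Cauchy-Schwarz, a unit vector of [V]
    gives outcome [s] probability at most [w s], the squared norm of column [s] of [Q]. These
    weights sum to the trace of [Q Q^*], which is the rank, and each [s] is counted at most [B]
    times. *)
Lemma sum_measured_le (C : numClosedFieldType) (N B : nat) (V : 'M[C]_N)
    (K : finType) (psi : K -> 'rV[C]_N) (E : K -> pred 'I_N) :
  (forall k, psi k *m (psi k)^t* = 1%:M) ->
  (forall k, (psi k <= V)%MS) ->
  (forall s, (#|[pred k | E k s]| <= B)%N) ->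
  \sum_k \sum_(s | E k s) `|psi k 0 s| ^+ 2 <= (B * \rank V)%:R.
Proof.
move=> psi1 psiV EB.
pose Q := schmidt (row_base V).
have Qu : Q \is unitarymx by rewrite schmidt_unitarymx// rank_leq_col.
have psiQ k : (psi k <= Q)%MS.
  by rewrite eqmx_schmidt_free ?row_base_free// eq_row_base.
pose w s := \sum_j `|Q j s| ^+ 2.
have sqE n (x : 'rV[C]_n) : x *m x^t* = (\sum_j `|x 0 j| ^+ 2)%:M.
  rewrite [LHS]mx11_scalar mxE; congr (_%:M).
  by apply: eq_bigr => j _; rewrite !mxE normCK.
have le_w k s : `|psi k 0 s| ^+ 2 <= w s.
  have /submxP[y psiE] := psiQ k.
  have y1 : \sum_j `|y 0 j| ^+ 2 = 1.
    have := psi1 k; rewrite psiE trmx_mul map_mxM mulmxA mulmxtVK // sqE.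
    by move/matrixP/(_ 0 0); rewrite !mxE.
  pose v : 'rV[C]_(\rank V) := \row_j Num.conj (Q j s).
  have -> : psi k 0 s = dotmx y v.
    by rewrite dotmxE psiE !mxE; apply: eq_bigr => j _; rewrite !mxE conjCK.
  have cs : `|dotmx y v| ^+ 2 <= dotmx y y * dotmx v v :=
    leif_le (CauchySchwarz (@dotmx C _) y v).
  have dotxx (x : 'rV_(\rank V)) : dotmx x x = \sum_j `|x 0 j| ^+ 2.
    by rewrite dotmxE mxE; apply: eq_bigr => j _; rewrite !mxE normCK.
  rewrite !dotxx y1 mul1r in cs; apply: (le_trans cs).
  by apply: ler_sum => j _; rewrite !mxE norm_conjC.
have w_ge0 s : 0 <= w s by apply: sumr_ge0 => j _; rewrite exprn_ge0.
have sum_w : \sum_s w s = (\rank V)%:R.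
  rewrite exchange_big /= -[RHS]mxtrace1 -(unitarymxP Qu).
  by apply: eq_bigr => j _; rewrite mxE; apply: eq_bigr => s _;
     rewrite !mxE normCK.
apply: (@le_trans _ _ (\sum_k \sum_(s | E k s) w s)).
  by do 2!apply: ler_sum => ? ?.
rewrite (exchange_big_dep predT)//= mulnC mulrnA -sum_w -sumrMnl.
apply: ler_sum => s _; rewrite sumr_const.
by rewrite ler_wpMn2l //; apply: EB.
Qed.

(** * The oracle and the span of the reachable states *)

Lemma oracle_funK (n m w : nat) (f : {ffun 'I_n -> 'I_m}) :
  involutive (@oracle_fun n m w f).
Proof.
move=> [[x b] z] /=; congr (_, _, _); apply: eq_from_tnth => i.
by rewrite !tnth_mktuple addbK.
Qed.

Lemma oracle_unitary (R : realType) (n m w : nat) (f : {ffun 'I_n -> 'I_m}) :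
  oracle R w f \is unitarymx.
Proof.
apply/unitarymxP/matrixP => i j; rewrite !mxE.
rewrite (bigD1 (enum_rank (oracle_fun f (enum_val i)))) //= big1 => [|k kNi].
  by rewrite !mxE enum_rankK oracle_funK eqxx mul1r addr0 rmorph_nat
    (inj_eq enum_val_inj) eq_sym.
rewrite !mxE; case: eqP => [ik|_]; last by rewrite mul0r.
by rewrite ik oracle_funK enum_valK eqxx in kNi.
Qed.

Lemma state_norm (R : realType) (n m : nat) (A : algorithm R n m)
    (f : {ffun 'I_n -> 'I_m}) (t : nat) :
  (state A f t)^T *m ((state A f t)^T)^t* = 1%:M.
Proof.
have mulK N (U : 'M[R[i]]_N) (x : 'cV_N) : U \is unitarymx ->
    (U *m x)^T *m ((U *m x)^T)^t* = x^T *m (x^T)^t*.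
  rewrite -trmx_unitary => UT.
  by rewrite !trmx_mul map_mxM mulmxA mulmxtVK.
elim: t => [|t IHt] /=; last by rewrite !mulK ?gate_unitary ?oracle_unitary.
rewrite mulK ?gate_unitary // [LHS]mx11_scalar mxE.
rewrite (bigD1 (enum_rank (basis0 n m (work A)))) //= big1 => [|k kN0].
  by rewrite !mxE eqxx mul1r addr0 rmorph1.
by rewrite !mxE (negPf kN0) mul0r.
Qed.

(* Some (i, a): the query string encodes i, and the oracle answers a;
   None: the query string encodes no element of [n]. *)
Definition oracle_part (R : realType) (n m w : nat)
    (o : option ('I_n * 'I_m)) : 'M[R[i]]_#|Defs.basis n m w| :=
  \matrix_(r, s)
    let: (x, b, z) := enum_val s in
    let ans :=
      if o is Some (_, a) then bits a else [tuple false | _ < nbits m] in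
    (([pick i | bits i == x] == omap fst o) &&
     (enum_val r == (x, xor_bits b ans, z)))%:R.

(** Only the 0/1 coefficients depend on [f]; on each basis vector exactly one selected part acts
    nontrivially. *)
Lemma oracleE (R : realType) (n m w : nat) (f : {ffun 'I_n -> 'I_m}) :
  oracle R w f =
  \sum_o (if o is Some (i, a) then f i == a else true)%:R *:
    oracle_part R n m w o.
Proof.
apply/matrixP => r s; rewrite summxE !mxE.
case s_xbz: (enum_val s) => [[x b] z] /=; rewrite /query_answer.
case xP: [pick i | bits i == x] => [i|].
  rewrite (bigD1 (Some (i, f i))) //= big1 => [|[[j a]|] //= ja].
  - by rewrite !mxE s_xbz xP !eqxx mul1r addr0.
  - rewrite !mxE s_xbz xP /=; case: eqP => [fj|]; last by rewrite mul0r.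
    case: eqP => [[ij]|]; last by rewrite mulr0.
    by rewrite ij fj eqxx in ja.
  - by rewrite !mxE s_xbz xP mulr0.
rewrite (bigD1 None) //= big1 => [|[[j a]|] //= _].
  by rewrite !mxE s_xbz xP !eqxx mul1r addr0.
by rewrite !mxE s_xbz xP mulr0.
Qed.

Lemma mxrank_sum_le (F : fieldType) (I : finType) (N r : nat)
    (V : I -> 'M[F]_N) :
  (forall i, (\rank (V i) <= r)%N) ->
  (\rank (\sum_i V i)%MS <= #|I| * r)%N.
Proof.
move=> Vr; rewrite -sum_nat_const.
elim/big_ind2: _ => [|A a B b Aa Bb|i _]; rewrite ?mxrank0 //.
by rewrite (leq_trans (mxrank_adds_leqif _ _)) // leq_add.
Qed.

(** The initial state is the same for all [f]. A query followed by a gate sends [V] into the sum of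
    its images under [(n * m).+1] fixed operators. *)
Lemma state_span (R : realType) (n m : nat) (A : algorithm R n m) (t : nat) :
  exists V : 'M[R[i]]_#|Defs.basis n m (work A)|,
    (\rank V <= (n * m).+1 ^ t)%N /\
    forall f, ((state A f t)^T <= V)%MS.
Proof.
elim: t => [|t [V [rV sV]]].
  exists <<(gate A 0 *m ket R (basis0 n m (work A)))^T>>%MS.
  by rewrite mxrank_gen rank_leq_row; split=> // f; rewrite genmxE.
exists (\sum_o V *m (gate A t.+1 *m oracle_part R n m (work A) o)^T)%MS; split.
  have cardO : #|{: option ('I_n * 'I_m)}| = (n * m).+1.
    by rewrite card_option card_prod !card_ord.
  rewrite expnS -{1}cardO; apply: mxrank_sum_le => o.
  exact: leq_trans (mxrankM_maxl _ _) rV.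
move=> f /=; rewrite oracleE mulmx_suml mulmx_sumr linear_sum /=.
apply: summx_sub_sums => o _.
rewrite -scalemxAl -scalemxAr linearZ /= scalemx_sub //.
by rewrite mulmxA [X in (X <= _)%MS]trmx_mul submxMr.
Qed.

(** An outcome determines the output, so it is accepted for at most [B] of the inputs, and
    [sum_measured_le] applies. *)
Lemma card_solved_le (R : realType) (n m : nat) (A : algorithm R n m)
    (K : finType) (f : K -> {ffun 'I_n -> 'I_m})
    (E : K -> pred {ffun 'I_m -> R}) (p : R) (B : nat) :
  (forall k, p <= output_prob A (f k) (E k)) ->
  (forall P, (#|[pred k | E k P]| <= B)%N) ->
  #|K|%:R * p <= (B * (n * m).+1 ^ queries A)%:R.
Proof.
move=> pE EB; have [V [rV sV]] := state_span R n m A (queries A).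
pose psi k := (state A (f k) (queries A))^T.
pose acc k : pred 'I_#|Defs.basis n m (work A)| :=
  fun s => E k (output (enum_val s)).
have probE k : (output_prob A (f k) (E k))%:C =
    \sum_(s | acc k s) `|psi k 0 s| ^+ 2.
  rewrite [RHS](reindex (@enum_rank _)) /=; last exact/onW_bij/enum_rank_bij.
  rewrite rmorph_sum; apply: eq_big => [s|s _].
    by rewrite /acc enum_rankK.
  by rewrite /outcome_prob mxE rmorphXn.
have leB := sum_measured_le _ _ B V K psi acc.
have {leB} : \sum_k (output_prob A (f k) (E k))%:C <= (B * \rank V)%:R.
  under eq_bigr do rewrite probE.
  by apply: leB => [k|k|s]; [exact: state_norm | exact: sV | exact: EB].
rewrite -rmorph_sum -(rmorph_nat (real_complex R)) lecR => leBr.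
apply: le_trans (_ : (B * \rank V)%:R <= _); last first.
  by rewrite ler_nat leq_mul2l rV orbT.
apply: le_trans leBr; rewrite mulr_natl -sumr_const.
by apply: ler_sum => k _; apply: pE.
Qed.

(** * Hamming balls and L1 distance *)

Definition hamming {I : finType} {J : eqType} (c d : {ffun I -> J}) : nat :=
  #|[pred i | c i != d i]|.

(* Chernoff's method: a word at distance h from d has weight 16 ^ (k - h), and
   the weights sum to (16 + 15) ^ k. *)
Lemma card_hamming_ball (k : nat) (d : {ffun 'I_k -> 'I_16}) :
  (#|[pred c : {ffun 'I_k -> 'I_16} | 2 * hamming c d <= k]| <= 8 ^ k)%N.
Proof.
pose wt i a := if a == d i then 16%N else 1%N.
have wtE (c : {ffun 'I_k -> 'I_16}) :
    (\prod_i wt i (c i) = 16 ^ (k - hamming c d))%N.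
  rewrite /wt -big_mkcond prod_nat_const; congr (16 ^ _)%N.
  apply: (canRL (addKn _)); rewrite -[RHS](card_ord k).
  rewrite -(cardC [pred i | c i != d i]); congr (_ + _)%N.
  by apply: eq_card => i; rewrite !inE negbK.
have sum_wt : (\sum_(c : {ffun 'I_k -> 'I_16}) \prod_i wt i (c i) = 31 ^ k)%N.
  rewrite -(bigA_distr_bigA wt) -[in RHS](card_ord k) -prod_nat_const.
  apply: eq_bigr => i _; rewrite (bigD1 (d i)) //= /wt eqxx.
  rewrite (eq_bigr (fun=> 1%N)) => [|a /negPf -> //].
  by rewrite sum1_card (cardC1 (d i)) card_ord.
(* Each word in the ball has weight at least [16 ^ (k/2) = 4 ^ k], while the total weight [31 ^ k]
   is at most [32 ^ k = 8 ^ k * 4 ^ k]. *)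
rewrite -(@leq_pmul2r (4 ^ k)) ?expn_gt0 // -expnMn.
apply: leq_trans (_ : 31 ^ k <= _)%N; last first.
  by case: (k) => // k1; rewrite leq_exp2r.
rewrite -sum_wt -sum_nat_const.
rewrite [leqRHS](bigID [pred c | 2 * hamming c d <= k]%N) /=.
apply: leq_trans (leq_addr _ _); apply: leq_sum => c; rewrite inE => ck.
rewrite wtE; change (4 ^ k <= (4 ^ 2) ^ (k - hamming c d))%N.
rewrite -expnM leq_exp2l //.
rewrite mulnBr leq_subRL; first by rewrite [leqRHS]mul2n -addnn leq_add2r.
by rewrite (leq_trans ck) // leq_pmull.
Qed.

Lemma L1dist_triangle (R : realType) (m : nat) (P Q S : {ffun 'I_m -> R}) :
  L1dist Q S <= L1dist P Q + L1dist P S.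
Proof.
rewrite -big_split; apply: ler_sum => j _ /=.
by rewrite (distrC (P j) (Q j)) ler_distD.
Qed.

(** Each [i] where the words differ contributes [1/n] at [h (i, c i)] and again at [h (i, d i)]; all
    these points are distinct. *)
Lemma L1dist_hamming (R : realType) (n m q : nat)
    (h : 'I_n * 'I_q -> 'I_m) (c d : {ffun 'I_n -> 'I_q}) : injective h ->
  (2 * hamming c d)%:R / n%:R <=
  L1dist (distr_of R [ffun i => h (i, c i)])
         (distr_of R [ffun i => h (i, d i)]).
Proof.
move=> h_inj.
have distrE (e : {ffun 'I_n -> 'I_q}) i a :
    distr_of R [ffun i => h (i, e i)] (h (i, a)) = (e i == a)%:R / n%:R.
  rewrite ffunE; congr (_%:R / _).
  case: eqP => [<-|ea]; last first.
    apply: eq_card0 => j; rewrite !inE ffunE; apply/eqP => /h_inj[ij].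
    by rewrite ij.
  apply: (@fintype.eq_card1 _ i) => j; rewrite !inE ffunE (inj_eq h_inj).
  by rewrite xpair_eqE; case: (eqVneq j i) => [->|//]; rewrite eqxx.
pose dist j := `|distr_of R [ffun i => h (i, c i)] j -
                 distr_of R [ffun i => h (i, d i)] j|.
apply: (@le_trans _ _ (\sum_i \sum_a dist (h (i, a)))); last first.
  rewrite pair_big /= (eq_bigr (fun p => dist (h p))) => [|[] //].
  rewrite -(big_imset dist (in2W h_inj)) big_mkcond.
  by apply: ler_sum => j _; case: ifP => // _; apply: normr_ge0.
rewrite natrM -mulrA mulrC -mulrA /hamming -sum1_card natr_sum mulr_suml.
rewrite big_mkcond; apply: ler_sum => i _; rewrite mul1r.
case: ifPn => [cd|_]; last by apply: sumr_ge0 => a _; apply: normr_ge0.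
rewrite (bigD1 (c i)) //= (bigD1 (d i)) 1?eq_sym //= /dist !distrE !eqxx.
rewrite eq_sym (negPf cd) !mul0r subr0 sub0r normrN.
rewrite addrA -mulr2n mulr1n mul1r mulr_natr ger0_norm ?invr_ge0 ?ler0n //.
by rewrite lerDl; apply: sumr_ge0 => a _; apply: normr_ge0.
Qed.

(** * Counting solved inputs and the asymptotic bound *)

Lemma queries_exp_ge (R : realType) (eps : R) (A : forall n m, algorithm R n m)
    (k m : nat) : eps < 1 / 2 -> solves_reconstruction eps A ->
  (0 < k)%N -> (16 * k <= m)%N -> (2 ^ k <= 2 * (k * m).+1 ^ queries (A k m))%N.
Proof.
move=> eps_half solA k_gt0 km.
have cardI : (#|{: 'I_k * 'I_16}| <= m)%N by rewrite card_prod !card_ord mulnC.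
pose h (p : 'I_k * 'I_16) : 'I_m := widen_ord cardI (enum_rank p).
have h_inj : injective h.
  by move=> p p' /(congr1 val)/= /val_inj/enum_rank_inj.
pose f (c : {ffun 'I_k -> 'I_16}) : {ffun 'I_k -> 'I_m} :=
  [ffun i => h (i, c i)].
pose E c (P : {ffun 'I_m -> R}) :=
  is_distr P && (L1dist P (distr_of R (f c)) <= eps).
have cardE P : (#|[pred c | E c P]| <= 8 ^ k)%N.
  (* All words accepted with [P] lie in the ball of radius [k/2] around any one of them, [d]. *)
  have [d dP|/eq_card0-> //] := pickP [pred c | E c P].
  apply: leq_trans (card_hamming_ball k d); apply: subset_leq_card.
  apply/fintype.subsetP => c; rewrite !inE in dP * => /andP[_ cP].
  have {dP} /andP[_ dP] := dP.
  rewrite -(ler_nat R) -[leRHS]mul1r -ler_pdivrMr ?ltr0n //.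
  apply: le_trans (L1dist_hamming R k m 16 h c d h_inj) _.
  apply: le_trans (L1dist_triangle R m P _ _) _.
  by apply: le_trans (lerD cP dP) _; lra.
have := card_solved_le R k m (A k m) _ f E (2 / 3) (8 ^ k)
  (fun c => solA k m k_gt0 (f c)) cardE.
rewrite card_ffun !card_ord mulrA ler_pdivrMr ?ltr0n // -!natrM ler_nat.
have -> : (16 ^ k = 8 ^ k * 2 ^ k)%N by rewrite -expnMn.
rewrite -!mulnA leq_pmul2l ?expn_gt0 // => le2.
(* The factor [3/2] from the success probability is rounded up to 2. *)
rewrite -(leq_pmul2r (isT : 0 < 2)%N) (leq_trans le2) //.
by rewrite mulnAC mulnC leq_mul2r orbT.
Qed.

Theorem theorem5p1 (R : realType) (eps : R) (eps_gt0 : 0 < eps)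
    (eps_lt_half : eps < 1 / 2) :
  exists c : R, 0 < c /\
  exists m0 : nat, forall A : (forall n m : nat, algorithm R n m),
    solves_reconstruction eps A ->
    forall m : nat, (m0 <= m)%N ->
      ((c * (m%:R / ln m%:R))%:E <= worst_queries A m)%E.
Proof.
have ln2_gt0 : 0 < ln 2 :> R by rewrite ln_gt0 // ltr1n.
(* Here 64 is 2 times 32: the 2 from the exponent [2 * T], the 32 from [m <= 32 * k]. *)
exists (ln 2 / 64); split; first by rewrite divr_gt0.
exists 64%N => A solA m m_ge64.
(* The inputs have domain size [k.+1], the floor of [m/16]; the extra 1 cancels the factor 2 of
   [queries_exp_ge]. *)
have [k k_ge3 [km mk]] :
    exists2 k, (3 <= k)%N & (16 * k.+1 <= m)%N /\ (m <= 32 * k)%N.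
  exists (m %/ 16).-1; lia.
apply: le_trans (_ : ((queries (A k.+1 m))%:R)%:E <= _)%E; last first.
  by apply: ereal_sup_ubound; exists k.+1.
have lnm_gt0 : 0 < ln m%:R :> R by rewrite ln_gt0 // ltr1n; lia.
rewrite lee_fin mulrA ler_pdivrMr //.
have := queries_exp_ge R eps A k.+1 m eps_lt_half solA isT km.
set T := queries _; rewrite expnS leq_pmul2l // => le2.
(* The base [(k.+1 * m).+1] is at most [m ^ 2]. *)
have {}le2 : (2 ^ k <= m ^ (2 * T))%N.
  apply: leq_trans le2 _; rewrite expnM; case: (T) => // t.
  by rewrite leq_exp2r // -mulnn; nia.
have {le2} : ln ((2 ^ k)%:R : R) <= ln ((m ^ (2 * T))%:R).
  by rewrite ler_ln ?posrE ?ltr0n ?ler_nat ?expn_gt0 //; lia.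
rewrite !natrX !lnXn ?ltr0n //; last lia.
rewrite -[in X in X -> _](mulr_natr (ln 2)).
rewrite -(mulr_natr (ln _) (2 * T)) natrM => le2.
have mkR : m%:R <= 32 * k%:R :> R by rewrite -natrM ler_nat.
have := ler_wpM2l (ltW ln2_gt0) mkR.
lra.
Qed.
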